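(* Let $U=\{1,\dots,n\}$ with distance function $d$ and continuation probabilities $p_i\in[a,b]$ for all $i\in U$, where $0<a\le b<1$. Let $\tau$ be an integer with $2\le\tau\le n$. Then the SB$\tau$I algorithm provides a $\frac{a^\tau(1-b)(1-b^{\tau-1})}{a^\tau(1-b)+b^{\tau+1}}$-approximation guarantee for MaxSSD. That is, for any ordering $O$ output by the algorithm, $$\mathcal{S}_+(O)\ \ge\ \frac{a^\tau(1-b)(1-b^{\tau-1})}{a^\tau(1-b)+b^{\tau+1}}\,\max_{O'}\mathcal{S}_+(O'),$$ the maximum being over all orderings $O'$ of $U$.
   Context: The distance function $d:U\times U\to\mathbb{R}_{\ge0}$ is symmetric with $d(i,i)=0$. For an ordering $O=(\pi(1),\dots,\pi(n))$ of $U$ let $O_k=(\pi(1),\dots,\pi(k))$, $p_{O_k}=\prod_{t=1}^kp_{\pi(t)}$ and $d(x,O_i)=\sum_{t=1}^id(x,\pi(t))$. The sequential sum diversity of $O$ is $\mathcal{S}_+(O)=\sum_{i=1}^{n-1}p_{O_{i+1}}\,d(\pi(i+1),O_i)$ (the expected sum of distances over unordered pairs of accepted items, when a user scans the items in order, accepts item $\pi(i)$ and continues with probability $p_{\pi(i)}$, and otherwise quits). MaxSSD asks for an ordering of $U$ maximizing $\mathcal{S}_+$. For a sequence $O_\tau$ of $\tau$ distinct items put $\mathcal{S}_+(O_\tau)=\sum_{i=1}^{\tau-1}p_{O_{i+1}}\,d(\pi(i+1),O_i)$. The SB$\tau$I algorithm chooses a sequence $O_\tau$ of $\tau$ distinct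 items maximizing $\mathcal{S}_+(O_\tau)$ over all sequences of $\tau$ distinct items of $U$, and then extends it to an ordering of all of $U$ by appending the remaining items in an arbitrary order. *)

(* Defs.v *)
From mathcomp Require Import all_boot all_order all_algebra.

Set Implicit Arguments.
Unset Strict Implicit.
Unset Printing Implicit Defensive.

Import Order.TTheory GRing.Theory Num.Theory.
Local Open Scope ring_scope.

(** Items are the elements of ['I_n], and sequences of [k] items are
    [k]-tuples.  Positions start at 0, so that [tnth O i] is pi(i+1). *)

Definition is_ordering (n : nat) (O : n.-tuple 'I_n) : bool :=
  perm_eq O (enum 'I_n).

Definition prefix_prob (R : realFieldType) (n k : nat) (p : 'I_n -> R)
    (O : k.-tuple 'I_n) (j : nat) : R :=
  \prod_(t < k | (t < j)%N) p (tnth O t).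

Definition dist_prefix (R : realFieldType) (n k : nat) (d : 'I_n -> 'I_n -> R)
    (x : 'I_n) (O : k.-tuple 'I_n) (j : nat) : R :=
  \sum_(t < k | (t < j)%N) d x (tnth O t).

Definition seq_sum_div (R : realFieldType) (n k : nat) (d : 'I_n -> 'I_n -> R)
    (p : 'I_n -> R) (O : k.-tuple 'I_n) : R :=
  \sum_(i < k | (1 <= i)%N)
    prefix_prob p O i.+1 * dist_prefix d (tnth O i) O i.

(** The default of the iterated maximum is the value of the ordering
    (0, ..., n-1), which is itself in the range: this is the true maximum. *)
Definition max_ssd (R : realFieldType) (n : nat) (d : 'I_n -> 'I_n -> R)
    (p : 'I_n -> R) : R :=
  \big[Num.max/seq_sum_div d p (ord_tuple n)]_(O : n.-tuple 'I_n | is_ordering O)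
    seq_sum_div d p O.

Definition best_start (R : realFieldType) (n tau : nat)
    (d : 'I_n -> 'I_n -> R) (p : 'I_n -> R) (O : tau.-tuple 'I_n) : Prop :=
  uniq O /\
  forall O' : tau.-tuple 'I_n,
    uniq O' -> seq_sum_div d p O' <= seq_sum_div d p O.

(** All possible outputs, over every choice of a best start (ties included)
    and every order of the remaining items. *)
Definition SBtauI_output (R : realFieldType) (n tau : nat)
    (d : 'I_n -> 'I_n -> R) (p : 'I_n -> R) (O : n.-tuple 'I_n) : Prop :=
  is_ordering O /\
  exists (Otau : tau.-tuple 'I_n) (rest : seq 'I_n),
    best_start d p Otau /\ tval O = tval Otau ++ rest.

(* Main.v *)
(** Write an ordering of U as s ++ x :: t with |s| = tau - 1, let M be the
    maximum of S_+ over orderings and W its maximum over sequences of tau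
    items.  Pairs inside s ++ [x] contribute at most W.  Pairs with one item in s
    and the other, y, in t: S_+(s ++ [y]) <= W forces d(y, s) <= W / a^tau, and
    the geometric tail of the probabilities sums to at most b^(tau+1) / (1 - b).
    Pairs inside x :: t contribute p_s S_+(x :: t) <= b^(tau-1) M, because
    (x :: t) ++ s is again an ordering.  Hence
    M <= W + b^(tau+1) / (a^tau (1 - b)) W + b^(tau-1) M. *)

Require Import Defs.
From mathcomp Require Import all_boot all_order all_algebra.
From mathcomp Require Import ring.

Import Order.TTheory GRing.Theory Num.Theory.
Local Open Scope ring_scope.

Definition seq_prob {R : realFieldType} {T : Type} (p : T -> R) (s : seq T) : R :=
  \prod_(x <- s) p x.

Definition dist_sum {R : realFieldType} {T : Type} (d : T -> T -> R)
    (s : seq T) (x : T) : R :=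
  \sum_(y <- s) d x y.

(** Expected total reward when the scan of [t] earns [f x] at each accepted
    item [x]. *)
Fixpoint scan_value {R : realFieldType} {T : Type} (p f : T -> R) (t : seq T) : R :=
  if t is x :: t' then p x * (f x + scan_value p f t') else 0.

(** Expected diversity gained by scanning [t] when the items of [s] have
    already been accepted; [ssd_after d p [::]] is S_+. *)
Fixpoint ssd_after {R : realFieldType} {T : Type} (d : T -> T -> R) (p : T -> R)
    (s t : seq T) : R :=
  if t is x :: t' then p x * (dist_sum d s x + ssd_after d p (rcons s x) t')
  else 0.

Section SequentialSumDiversity.
Context {R : realFieldType} {T : Type}.
Implicit Types (d : T -> T -> R) (p f : T -> R) (s t : seq T) (x : T) (b c : R).

Lemma seq_prob_rcons p s x : seq_prob p (rcons s x) = seq_prob p s * p x.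
Proof. by rewrite /seq_prob -cats1 big_cat big_seq1. Qed.

Lemma dist_sum_cat d s t x : dist_sum d (s ++ t) x = dist_sum d s x + dist_sum d t x.
Proof. exact: big_cat. Qed.

(** The scan reaches [u] only if every item of [t] is accepted, and by then [t] has joined the
    accepted items. *)
Lemma ssd_after_cat d p s t u :
  ssd_after d p s (t ++ u) =
  ssd_after d p s t + seq_prob p t * ssd_after d p (s ++ t) u.
Proof.
elim: t s => [|x t IHt] s /=.
  by rewrite cats0 /seq_prob big_nil add0r mul1r.
by rewrite IHt cat_rcons /seq_prob big_cons; ring.
Qed.

(** The gain at an item is additive in the items accepted before it, so the pairs crossing from [s]
    into [t] separate from the pairs that avoid [s]. *)
Lemma ssd_after_split d p s t u :
  ssd_after d p (s ++ u) t = scan_value p (dist_sum d s) t + ssd_after d p u t.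
Proof.
elim: t u => [|x t IHt] u /=; first by rewrite addr0.
by rewrite rcons_cat IHt dist_sum_cat; ring.
Qed.

Lemma ssd_rcons d p s x :
  ssd_after d p [::] (rcons s x) =
  ssd_after d p [::] s + seq_prob p (rcons s x) * dist_sum d s x.
Proof. by rewrite -cats1 ssd_after_cat /= addr0 cats1 seq_prob_rcons mulrA. Qed.

(** Unrolls the recursion into a sum over positions, the shape of [seq_sum_div]; [x0] is only the
    default of [nth]. *)
Lemma ssd_after_sum d p x0 s t :
  ssd_after d p s t =
  \sum_(i < size t)
    seq_prob p (take i.+1 t) * dist_sum d (s ++ take i t) (nth x0 t i).
Proof.
elim: t s => [|x t IHt] s /=; first by rewrite big_ord0.
rewrite big_ord_recl /= take0 cats0 {1}/seq_prob big_seq1 mulrDr IHt.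
congr (_ + _); rewrite mulr_sumr; apply: eq_bigr => i _.
by rewrite cat_rcons {2}/seq_prob big_cons mulrA.
Qed.

Lemma seq_prob_ge0 p s : (forall x, 0 <= p x) -> 0 <= seq_prob p s.
Proof. by move=> p_ge0; apply: prodr_ge0. Qed.

Lemma dist_sum_ge0 d s x : (forall x y, 0 <= d x y) -> 0 <= dist_sum d s x.
Proof. by move=> d_ge0; apply: sumr_ge0. Qed.

Lemma ssd_after_ge0 d p s t :
  (forall x y, 0 <= d x y) -> (forall x, 0 <= p x) -> 0 <= ssd_after d p s t.
Proof.
move=> d_ge0 p_ge0; elim: t s => //= x t IHt s.
by rewrite mulr_ge0 ?addr_ge0 ?dist_sum_ge0.
Qed.

Lemma le_ssd_catr d p s t : (forall x y, 0 <= d x y) -> (forall x, 0 <= p x) ->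
  ssd_after d p [::] s <= ssd_after d p [::] (s ++ t).
Proof.
by move=> d_ge0 p_ge0; rewrite ssd_after_cat lerDl mulr_ge0 ?seq_prob_ge0 ?ssd_after_ge0.
Qed.

Lemma seq_prob_le p b s : (forall x, 0 <= p x <= b) -> seq_prob p s <= b ^+ size s.
Proof.
move=> p_le; elim: s => [|x s IHs]; first by rewrite /seq_prob big_nil.
have /andP[px_ge0 px_le] := p_le x.
rewrite /seq_prob big_cons exprS ler_pM // seq_prob_ge0 // => y.
by have /andP[] := p_le y.
Qed.

Lemma seq_prob_ge p (a : R) s :
  0 <= a -> (forall x, a <= p x) -> a ^+ size s <= seq_prob p s.
Proof.
move=> a_ge0 p_ge; elim: s => [|x s IHs]; first by rewrite /seq_prob big_nil.
by rewrite /seq_prob big_cons exprS ler_pM // exprn_ge0.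
Qed.

End SequentialSumDiversity.

(** The value is dominated by the geometric series c (b + b^2 + ...), whose sum is the fixed point
    of v = b (c + v). The bound on [f] is asked on [t] only, since distances to a prefix will be
    controlled only for items outside it. *)
Lemma scan_value_le {R : realFieldType} {T : eqType} (p f : T -> R) (b c : R)
    (t : seq T) :
  0 <= c -> 0 <= b -> b < 1 -> (forall x, 0 <= p x <= b) -> {in t, forall x, f x <= c} ->
  scan_value p f t <= c * (b / (1 - b)).
Proof.
move=> c_ge0 b_ge0 b_lt1 p_le; have b1_gt0 : 0 < 1 - b by rewrite subr_gt0.
elim: t => [|x t IHt] f_le /=.
  by rewrite mulr_ge0 // divr_ge0 // ltW.
have /andP[px_ge0 px_le] := p_le x.
have cb_ge0 : 0 <= c / (1 - b) by rewrite divr_ge0 // ltW.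
have -> : c * (b / (1 - b)) = b * (c / (1 - b)) by ring.
apply: le_trans (ler_wpM2r cb_ge0 px_le); apply: ler_wpM2l => //.
have -> : c / (1 - b) = c + c * (b / (1 - b)) by field; rewrite gt_eqF.
by rewrite lerD ?f_le ?mem_head ?IHt // => y ty; rewrite f_le // inE ty orbT.
Qed.

Lemma big_tuple_take {S : Type} {idx : S} (op : Monoid.law idx) {T : Type} {k : nat}
    (O : k.-tuple T) (j : nat) (F : T -> S) :
  (j <= k)%N ->
  \big[op/idx]_(t < k | (t < j)%N) F (tnth O t) = \big[op/idx]_(x <- take j O) F x.
Proof.
case: k O => [|k] O le_jk.
  by move: le_jk; rewrite leqn0 => /eqP ->; rewrite big_ord0 take0 big_nil.
pose x0 := tnth O ord0.
rewrite (eq_bigr (fun t : 'I_k.+1 => F (nth x0 O t))); last first.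
  by move=> t _; rewrite (tnth_nth x0).
rewrite -(big_ord_widen _ (fun i => F (nth x0 O i)) le_jk) (big_nth x0) size_take size_tuple.
have -> : (if (j < k.+1)%N then j else k.+1) = j.
  by case: ltnP => // ?; apply/eqP; rewrite eqn_leq le_jk andbT.
by rewrite big_mkord; apply: eq_bigr => i _; rewrite nth_take.
Qed.

Lemma seq_sum_divE {R : realFieldType} {n k : nat} (d : 'I_n -> 'I_n -> R)
    (p : 'I_n -> R) (O : k.-tuple 'I_n) :
  seq_sum_div d p O = ssd_after d p [::] O.
Proof.
case: k O => [|k] O; first by rewrite /seq_sum_div big_ord0 (tuple0 O).
rewrite (ssd_after_sum d p (tnth O ord0)) size_tuple /seq_sum_div big_mkcond /=.
apply: eq_bigr => i _.
rewrite /prefix_prob /dist_prefix !big_tuple_take // ?(ltnW (ltn_ord i)) //.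
(* Position 0 is filtered out of [seq_sum_div]; on the other side its term vanishes, as no item
   precedes it. *)
rewrite -(tnth_nth _ O); case: ltnP => //; rewrite leqn0 => /eqP ->.
by rewrite /dist_sum take0 big_nil mulr0.
Qed.

Lemma ssd_le_max {R : realFieldType} {n : nat} (d : 'I_n -> 'I_n -> R)
    (p : 'I_n -> R) (s : seq 'I_n) :
  perm_eq s (enum 'I_n) -> ssd_after d p [::] s <= max_ssd d p.
Proof.
move=> ps; have sz : size s == n by rewrite (perm_size ps) size_enum_ord.
rewrite -[s]/(tval (Tuple sz)) -seq_sum_divE /max_ssd.
exact: (le_bigmax_cond _ (seq_sum_div d p)).
Qed.

(** Here [k] stands for tau - 1. The maximum stays on the right, so that maximizing over [s] yields
    an inequality to be solved for it. *)
Lemma ssd_ordering_le {R : realFieldType} {n k : nat} (d : 'I_n -> 'I_n -> R)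
    (p : 'I_n -> R) (a b W : R) (s : seq 'I_n) :
  (forall i j, 0 <= d i j) -> 0 < a -> b < 1 -> (forall i, a <= p i <= b) ->
  (k < n)%N ->
  (forall u, size u = k.+1 -> uniq u -> ssd_after d p [::] u <= W) ->
  perm_eq s (enum 'I_n) ->
  ssd_after d p [::] s <=
    W + b ^+ k.+2 / (a ^+ k.+1 * (1 - b)) * W + b ^+ k * max_ssd d p.
Proof.
move=> d_ge0 a_gt0 b_lt1 p_ab lt_kn W_max ps.
have p_ge0 i : 0 <= p i by have /andP[/(le_trans (ltW a_gt0))] := p_ab i.
have p_ge i : a <= p i by have /andP[] := p_ab i.
have p_le i : 0 <= p i <= b by rewrite p_ge0; have /andP[] := p_ab i.
have us : uniq s by rewrite (perm_uniq ps) enum_uniq.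
have sz : size s = n by rewrite (perm_size ps) size_enum_ord.
have [u [x [t [def_s sz_u]]]] : exists u x t, s = u ++ x :: t /\ size u = k.
  have lt_ks : (k < size s)%N by rewrite sz.
  case E : (drop k s) => [|x t].
    by move: (size_drop k s); rewrite E /= => /esym/eqP; rewrite subn_eq0 leqNgt lt_ks.
  by exists (take k s), x, t; rewrite -E cat_take_drop size_takel // ltnW.
have Wx y : y \in x :: t -> ssd_after d p [::] (rcons u y) <= W.
  move=> ty; apply: W_max; first by rewrite size_rcons sz_u.
  by move: us; rewrite def_s cat_uniq rcons_uniq => /and3P[-> /hasPn/(_ y ty) /= -> _].
have W_ge0 : 0 <= W by apply: le_trans (Wx x (mem_head _ _)); apply: ssd_after_ge0.
have ak_gt0 : 0 < a ^+ k.+1 by rewrite exprn_gt0.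
have b1_gt0 : 0 < 1 - b by rewrite subr_gt0.
have b_ge0 : 0 <= b by have /andP[/le_trans] := p_le x; apply.
(* Dropping the nonnegative value of [u] from that of [rcons u y] leaves the term of [y], whose
   probability is at least [a ^+ k.+1]. *)
have du_le : {in t, forall y, dist_sum d u y <= W / a ^+ k.+1}.
  move=> y ty; rewrite ler_pdivlMr // mulrC.
  apply: le_trans (Wx y _); last by rewrite inE ty orbT.
  rewrite ssd_rcons -[leLHS]add0r lerD ?ssd_after_ge0 // ler_wpM2r ?dist_sum_ge0 //.
  have <- : size (rcons u y) = k.+1 by rewrite size_rcons sz_u.
  by apply: seq_prob_ge => //; exact: ltW.
(* The pivot [x] is paired with [u] in the first term and with [t] in the last; the middle term
   holds the pairs between [u] and [t]. *)
have -> : ssd_after d p [::] s =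
    ssd_after d p [::] (rcons u x)
    + seq_prob p (rcons u x) * scan_value p (dist_sum d u) t
    + seq_prob p u * ssd_after d p [::] (x :: t).
  rewrite def_s ssd_after_cat -[[::] ++ u]cats0 ssd_after_split ssd_rcons.
  by rewrite seq_prob_rcons /=; ring.
apply: lerD; first apply: lerD.
- by rewrite Wx ?mem_head.
(* [b ^+ k.+1] bounds the probability of passing [rcons u x]; the other factor is the geometric
   bound on the scan of [t]. *)
- have -> : b ^+ k.+2 / (a ^+ k.+1 * (1 - b)) * W =
      b ^+ k.+1 * (W / a ^+ k.+1 * (b / (1 - b))).
    by rewrite [b ^+ k.+2]exprSr; field; rewrite !gt_eqF.
  have rhs_ge0 : 0 <= W / a ^+ k.+1 * (b / (1 - b)).
    by rewrite mulr_ge0 // divr_ge0 // ltW.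
  apply: (@le_trans _ _ (seq_prob p (rcons u x) * (W / a ^+ k.+1 * (b / (1 - b))))).
    by rewrite ler_wpM2l ?seq_prob_ge0 // scan_value_le // divr_ge0 // ltW.
  rewrite ler_wpM2r //.
  have <- : size (rcons u x) = k.+1 by rewrite size_rcons sz_u.
  exact: seq_prob_le.
apply: ler_pM; rewrite ?seq_prob_ge0 ?ssd_after_ge0 //.
  by rewrite -[in leRHS]sz_u seq_prob_le.
apply: le_trans (le_ssd_catr _ _ _ u d_ge0 p_ge0) (ssd_le_max _ _ _ _).
by rewrite perm_catC -def_s.
Qed.

Theorem theorem8p2 (R : realFieldType) (n tau : nat)
    (d : 'I_n -> 'I_n -> R) (p : 'I_n -> R) (a b : R)
    (d_ge0 : forall i j : 'I_n, 0 <= d i j)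
    (d_sym : forall i j : 'I_n, d i j = d j i)
    (d_diag : forall i : 'I_n, d i i = 0)
    (a_gt0 : 0 < a) (le_ab : a <= b) (b_lt1 : b < 1)
    (p_bounds : forall i : 'I_n, a <= p i <= b)
    (tau_ge2 : (2 <= tau)%N) (tau_len : (tau <= n)%N)
    (O : n.-tuple 'I_n) (O_out : SBtauI_output tau d p O) :
  seq_sum_div d p O >=
    (a ^+ tau * (1 - b) * (1 - b ^+ (tau - 1)))
      / (a ^+ tau * (1 - b) + b ^+ tau.+1)
    * max_ssd d p.
Proof.
case: tau tau_ge2 tau_len O_out => // k k_gt0 lt_kn [_ [Ot [rest [[_ Ot_best] defO]]]].
have p_ge0 i : 0 <= p i by have /andP[/(le_trans (ltW a_gt0))] := p_bounds i.
have b_gt0 : 0 < b := lt_le_trans a_gt0 le_ab.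
set W := seq_sum_div d p Ot.
(* Whatever the order of the appended items, they cannot lower the value of the best start. *)
have W_le : W <= seq_sum_div d p O by rewrite /W !seq_sum_divE defO le_ssd_catr.
apply: le_trans W_le; rewrite subn1 /=.
have W_max u : size u = k.+1 -> uniq u -> ssd_after d p [::] u <= W.
  move=> /eqP sz uu; rewrite -[u]/(tval (Tuple sz)) -seq_sum_divE.
  exact: Ot_best.
have M_le : max_ssd d p <=
    W + b ^+ k.+2 / (a ^+ k.+1 * (1 - b)) * W + b ^+ k * max_ssd d p.
  (* The default of the iterated maximum must obey the bound too; it does, being the value of an
     ordering. *)
  rewrite {1}/max_ssd; apply: bigmax_le => [|O' O'_ord]; rewrite seq_sum_divE.
    by apply: ssd_ordering_le => //; rewrite val_ord_tuple.
  exact: ssd_ordering_le.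
have A_gt0 : 0 < a ^+ k.+1 * (1 - b) by rewrite mulr_gt0 ?exprn_gt0 ?subr_gt0.
have B_gt0 : 0 < b ^+ k.+2 by rewrite exprn_gt0.
(* With A = [a ^+ k.+1 * (1 - b)], B = [b ^+ k.+2] and M the maximum, the goal becomes A (1 - b^k) M
   <= W (A + B), which is [M_le] with b^k M moved to the left and both sides multiplied by A. *)
rewrite mulrAC ler_pdivrMr ?addr_gt0 //.
move: M_le; rewrite -lerBlDr -[X in X - _]mul1r -mulrBl -(ler_pM2l A_gt0).
rewrite mulrA [_ * (W + _)](_ : _ = W * (a ^+ k.+1 * (1 - b) + b ^+ k.+2)) //.
by field; rewrite !gt_eqF ?exprn_gt0 ?subr_gt0.
Qed.
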